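(* Let $d\ge 4$ be an integer and let $$Z=\frac12\begin{bmatrix}1&\frac{d-3}{d}\\ \frac{d-3}{d}&1\end{bmatrix}\in\mathbb{M}_2.$$ Then $\mathcal{MR}\!\left(Z,\frac{I_d}{d}\right)=d=\lfloor\sqrt{2^2+d^2-1}\rfloor$.
   Context: $\mathbb{M}_n$ is the algebra of complex $n\times n$ matrices with identity $I_n$. A linear map $\Phi:\mathbb{M}_{d_1}\to\mathbb{M}_{d_2}$ is completely positive (CP) if and only if $\Phi(X)=\sum_{j=1}^r V_j^*XV_j$ for some complex $d_1\times d_2$ matrices $V_j$; the smallest possible $r$ is the Choi-rank $CR(\Phi)$. $\Phi^*:\mathbb{M}_{d_2}\to\mathbb{M}_{d_1}$ is the dual map defined by $\mathrm{tr}(\Phi(X)^*Y)=\mathrm{tr}(X^*\Phi^*(Y))$. For $A_1\in\mathbb{M}_{d_1}$, $A_2\in\mathbb{M}_{d_2}$, let $\mathcal{CP}[\mathbb{M}_{d_1},\mathbb{M}_{d_2};A_1,A_2]$ be the convex set of all CP maps $\Phi:\mathbb{M}_{d_1}\to\mathbb{M}_{d_2}$ with $\Phi(I_{d_1})=A_2$ and $\Phi^*(I_{d_2})=A_1$, and let $\mathcal{MR}(A_1,A_2)=\sup\{CR(\Phi):\Phi\text{ is an extreme point of }\mathcal{CP}[\mathbb{M}_{d_1},\mathbb{M}_{d_2};A_1,A_2]\}$. $\lfloor a\rfloor$ is the largest integer not exceeding $a$. Here $d_1=2$, $d_2=d$. *)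

(* Defs.v *)
From HB Require Import structures.
From mathcomp Require Import all_boot all_order all_algebra.
From mathcomp Require Import complex.
From mathcomp Require Import boolp classical_sets reals constructive_ereal ereal.

Set Implicit Arguments.
Unset Strict Implicit.
Unset Printing Implicit Defensive.

Import Order.TTheory GRing.Theory Num.Theory.

Local Open Scope classical_set_scope.
Local Open Scope complex_scope.
Local Open Scope sesquilinear_scope.
Local Open Scope ring_scope.

(* 'Hom(aT, rT) carries Leibniz equality and the pointwise vector-space
   structure, which is what extreme points need. *)
Notation linmap R d1 d2 := 'Hom('M[complex R]_d1, 'M[complex R]_d2).

Section CompletelyPositive.
Variables (R : realType) (d1 d2 : nat).
Implicit Types Phi : linmap R d1 d2.

Definition kraus_length Phi (r : nat) : Prop :=
  exists V : 'I_r -> 'M[complex R]_(d1, d2),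
    forall X, Phi X = \sum_(j < r) (V j)^t* *m X *m V j.

Definition completely_positive Phi : Prop := exists r, kraus_length Phi r.

Lemma completely_positive_bool Phi :
  completely_positive Phi -> exists r, `[< kraus_length Phi r >].
Proof. by case=> r Vr; exists r; apply/asboolP. Qed.

(* Junk value 0 when Phi is not completely positive. *)
Definition choi_rank Phi : nat :=
  if pselect (completely_positive Phi) is left cpPhi
  then ex_minn (completely_positive_bool cpPhi) else 0%N.

(* The (i, j) entry of M is \tr (E_ij^* M), which forces this formula; the
   defining adjunction and uniqueness are dual_mapP and dual_map_unique. *)
Definition dual_map Phi (Y : 'M[complex R]_d2) : 'M[complex R]_d1 :=
  \matrix_(i, j) \tr ((Phi (delta_mx i j))^t* *m Y).

Definition CP_set (A1 : 'M[complex R]_d1) (A2 : 'M[complex R]_d2) :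
    set (linmap R d1 d2) :=
  [set Phi | [/\ completely_positive Phi,
                 Phi 1%:M = A2 & dual_map Phi 1%:M = A1]].

Definition extreme_points (S : set (linmap R d1 d2)) : set (linmap R d1 d2) :=
  [set Phi | S Phi /\
    forall (Psi1 Psi2 : linmap R d1 d2) (t : R),
      S Psi1 -> S Psi2 -> 0 < t -> t < 1 ->
      Phi = t%:C *: Psi1 + (1 - t)%:C *: Psi2 -> Psi1 = Phi /\ Psi2 = Phi].

(* The supremum is taken in the extended reals, so no boundedness or
   nonemptiness is presupposed. *)
Definition MR (A1 : 'M[complex R]_d1) (A2 : 'M[complex R]_d2) : \bar R :=
  ereal_sup [set ((choi_rank Phi)%:R)%:E | Phi in extreme_points (CP_set A1 A2)].

Lemma trmxC_delta_mul m n (M : 'M[complex R]_(m, n)) i j :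
  \tr ((delta_mx i j)^t* *m M) = M i j.
Proof.
rewrite /mxtrace (bigD1 j) //= big1 ?addr0 => [|k /negPf kj].
  rewrite mxE (bigD1 i) //= big1 ?addr0 => [|l /negPf li].
    by rewrite !mxE !eqxx rmorph1 mul1r.
  by rewrite !mxE li rmorph0 mul0r.
by rewrite mxE big1 // => l _; rewrite !mxE kj andbF rmorph0 mul0r.
Qed.

Lemma dual_mapP Phi X Y :
  \tr ((Phi X)^t* *m Y) = \tr (X^t* *m dual_map Phi Y).
Proof.
have conjmx_sum m n (I : finType) (F : I -> 'M[complex R]_(m, n)) :
    (\sum_i F i)^t* = \sum_i (F i)^t*.
  by rewrite !raddf_sum.
have conjmxZ m n a (M : 'M[complex R]_(m, n)) : (a *: M)^t* = a^* *: M^t*.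
  by apply/matrixP=> i j; rewrite !mxE rmorphM.
rewrite {1 2}(matrix_sum_delta X) linear_sum !conjmx_sum !mulmx_suml !raddf_sum.
apply: eq_bigr => i _; rewrite linear_sum !conjmx_sum !mulmx_suml !raddf_sum.
apply: eq_bigr => j _; rewrite linearZ !conjmxZ -!scalemxAl /= !mxtraceZ.
by rewrite trmxC_delta_mul mxE.
Qed.

Lemma dual_map_unique Phi (Psi : 'M[complex R]_d2 -> 'M[complex R]_d1) :
  (forall X Y, \tr ((Phi X)^t* *m Y) = \tr (X^t* *m Psi Y)) ->
  Psi =1 dual_map Phi.
Proof.
move=> PsiP Y; apply/matrixP=> i j.
by rewrite -[LHS]trmxC_delta_mul -PsiP mxE.
Qed.

End CompletelyPositive.

Definition Zmat (R : realType) (d : nat) : 'M[complex R]_2 :=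
  2^-1 *: \matrix_(i, j) (if i == j then 1 else (d%:R - 3) / d%:R).

(* Main.v *)
(* Upper bound: if r Kraus operators V_i of an extreme point satisfied
   r^2 > d1^2 + d2^2, some nonzero Hermitian H would give
   \sum H_ij V_i^* V_j = 0 and \sum H_ij V_j V_i^* = 0. Diagonalising H by a
   unitary change of Kraus operators and rescaling, H = diag(D_i) with
   |D_i| <= 1 and some D_i0 = 1. The weights 1 + D_i and 1 - D_i then split the
   map into two members of the set, so by extremality both equal the map; but
   the second needs one Kraus operator fewer. For d >= 4 this yields
   r^2 <= d^2 + 4 < (d + 1)^2.

   Lower bound: for w_j in C^2 let V_j = w_j e_j^T, i.e. X is sent to
   diag(w_j^* X w_j). If no two w_j are orthogonal this map is extreme.
   Taking w_j = (1, z_j) / sqrt(2 d), where the z_j are 1 (d - 2 times) and the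
   two primitive cube roots of unity, the phases sum to d - 3 and no ratio
   z_j / z_i is -1. The rank is d since E_00 is sent to I / (2 d). *)
Require Import Defs.
From HB Require Import structures.
From mathcomp Require Import all_boot all_order all_algebra.
From mathcomp Require Import complex.
From mathcomp Require Import boolp classical_sets reals constructive_ereal ereal.
From mathcomp Require Import ring lra zify.

Set Implicit Arguments.
Unset Strict Implicit.
Unset Printing Implicit Defensive.

Import Order.TTheory GRing.Theory Num.Theory.
Local Open Scope ring_scope.
Local Open Scope sesquilinear_scope.

(** * Rules for the conjugate transpose *)

Section Adjoint.
Variable C : numClosedFieldType.

Lemma adjmxM m n p (A : 'M[C]_(m, n)) (B : 'M[C]_(n, p)) :
  (A *m B)^t* = B^t* *m A^t*.
Proof. by rewrite trmx_mul map_mxM. Qed.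

Lemma adjmxZ m n (a : C) (A : 'M[C]_(m, n)) : (a *: A)^t* = a^* *: A^t*.
Proof. by apply/matrixP=> i j; rewrite !mxE rmorphM. Qed.

Lemma adjmx_sum m n (I : finType) (F : I -> 'M[C]_(m, n)) :
  (\sum_i F i)^t* = \sum_i (F i)^t*.
Proof. by rewrite !raddf_sum. Qed.

Lemma adjmx_delta m n (i : 'I_m) (j : 'I_n) :
  (delta_mx i j : 'M[C]_(m, n))^t* = delta_mx j i.
Proof. by apply/matrixP=> k l; rewrite !mxE rmorph_nat andbC. Qed.

End Adjoint.

(** * Kraus families and their minimal length *)

Section Kraus.
Variables (R : realType) (d1 d2 : nat).
Local Notation C := (complex R).
Implicit Types Phi : linmap R d1 d2.

Section Family.
Variables (r : nat) (V : 'I_r -> 'M[C]_(d1, d2)).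

Definition kraus_sum (X : 'M[C]_d1) : 'M[C]_d2 :=
  \sum_j (V j)^t* *m X *m V j.

Fact kraus_sum_is_linear : linear kraus_sum.
Proof.
move=> a X Y; rewrite /kraus_sum scaler_sumr -big_split; apply: eq_bigr => j _.
by rewrite mulmxDr mulmxDl -scalemxAr -scalemxAl.
Qed.
HB.instance Definition _ :=
  GRing.isLinear.Build C 'M[C]_d1 'M[C]_d2 *:%R kraus_sum kraus_sum_is_linear.

Definition kraus_map : linmap R d1 d2 := linfun kraus_sum.

Lemma kraus_mapE X : kraus_map X = \sum_j (V j)^t* *m X *m V j.
Proof. by rewrite lfunE. Qed.

Lemma kraus_length_map : kraus_length kraus_map r.
Proof. by exists V => X; rewrite kraus_mapE. Qed.

Lemma kraus_map1 : kraus_map 1%:M = \sum_j (V j)^t* *m V j.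
Proof. by rewrite kraus_mapE; apply: eq_bigr => j _; rewrite mulmx1. Qed.

Lemma dual_kraus_map1 : dual_map kraus_map 1%:M = \sum_j V j *m (V j)^t*.
Proof.
pose Psi (Y : 'M[C]_d2) := \sum_j V j *m Y *m (V j)^t*.
have -> : dual_map kraus_map 1%:M = Psi 1%:M.
  apply/esym/dual_map_unique => X Y.
  rewrite kraus_mapE adjmx_sum mulmx_suml mulmx_sumr !raddf_sum.
  apply: eq_bigr => j _ /=; rewrite !adjmxM trmxCK -!mulmxA mxtrace_mulC.
  by rewrite -!mulmxA.
by apply: eq_bigr => j _; rewrite mulmx1.
Qed.

End Family.

Lemma choi_rankP Phi r : kraus_length Phi r ->
  kraus_length Phi (choi_rank Phi) /\ (choi_rank Phi <= r)%N.
Proof.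
move=> PhiV; rewrite /choi_rank; case: pselect => [cp|[]]; last by exists r.
case: ex_minnP => m /asboolP Phim mmin; split=> //.
by apply: mmin; apply/asboolP.
Qed.

Lemma kraus_length_choi_rank Phi :
  completely_positive Phi -> kraus_length Phi (choi_rank Phi).
Proof. by case=> r /choi_rankP []. Qed.

Lemma choi_rank_le Phi r : kraus_length Phi r -> (choi_rank Phi <= r)%N.
Proof. by case/choi_rankP. Qed.

Lemma kraus_length_kraus_map Phi r : kraus_length Phi r ->
  exists V : 'I_r -> 'M[C]_(d1, d2), Phi = kraus_map V.
Proof. by case=> V PhiV; exists V; apply/lfunP => X; rewrite kraus_mapE. Qed.

Lemma kraus_length_drop0 r (V : 'I_r -> 'M[C]_(d1, d2)) i :
  V i = 0 -> kraus_length (kraus_map V) r.-1.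
Proof.
move=> Vi0; exists (fun j => V (lift i j)) => X.
by rewrite kraus_mapE (bigD1_ord i) //= Vi0 mulmx0 add0r.
Qed.

(** The square root makes each Kraus term scale by [c i] itself when [c i] is nonnegative. *)
Definition weighted r (c : 'I_r -> C) (V : 'I_r -> 'M[C]_(d1, d2)) i :=
  sqrtC (c i) *: V i.

Lemma weighted_sandwich r (c : 'I_r -> C) (V : 'I_r -> 'M[C]_(d1, d2)) X i :
  0 <= c i ->
  (weighted c V i)^t* *m X *m weighted c V i =
    c i *: ((V i)^t* *m X *m V i).
Proof.
move=> ci; rewrite /weighted adjmxZ -!scalemxAl -scalemxAr scalerA.
by rewrite -normCKC ger0_norm ?sqrtC_ge0 // sqrtCK.
Qed.

Lemma weighted_dual_sandwich r (c : 'I_r -> C) (V : 'I_r -> 'M[C]_(d1, d2)) i :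
  0 <= c i ->
  weighted c V i *m (weighted c V i)^t* = c i *: (V i *m (V i)^t*).
Proof.
move=> ci; rewrite /weighted adjmxZ -scalemxAl -scalemxAr scalerA.
by rewrite -normCK ger0_norm ?sqrtC_ge0 // sqrtCK.
Qed.

(** * Linear recombination of Kraus operators *)

Section Mixing.
Variables (r : nat) (V : 'I_r -> 'M[C]_(d1, d2)) (P : 'M[C]_r).

Definition mixed i := \sum_j P i j *: V j.

(** Expanding both copies of [mixed] leaves the [(i, j)] entry of [P^t* D P] as coefficient. Read
    from right to left with [P] diagonalising [H], this turns a relation with coefficients [H] into
    a diagonal one. *)
Lemma mixed_sandwich (D : 'rV[C]_r) X :
  \sum_i D 0 i *: ((mixed i)^t* *m X *m mixed i) =
  \sum_i \sum_j (P^t* *m diag_mx D *m P) i j *: ((V i)^t* *m X *m V j).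
Proof.
under [RHS]eq_bigr => i _ do under eq_bigr => j _ do
  rewrite mul_mx_diag mxE scaler_suml.
under [RHS]eq_bigr => i _ do rewrite exchange_big.
rewrite [RHS]exchange_big; apply: eq_bigr => k _; rewrite /mixed.
rewrite adjmx_sum !mulmx_suml scaler_sumr; apply: eq_bigr => i _.
rewrite mulmx_sumr scaler_sumr; apply: eq_bigr => j _.
rewrite adjmxZ -!scalemxAl -scalemxAr !scalerA !mxE; congr (_ *: _).
by rewrite [D 0 k * _]mulrC.
Qed.

(** Here the adjoint is the right factor, so the same coefficient multiplies the product with [i]
    and [j] exchanged. *)
Lemma mixed_dual_sandwich (D : 'rV[C]_r) :
  \sum_i D 0 i *: (mixed i *m (mixed i)^t*) =
  \sum_i \sum_j (P^t* *m diag_mx D *m P) i j *: (V j *m (V i)^t*).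
Proof.
under [RHS]eq_bigr => i _ do under eq_bigr => j _ do
  rewrite mul_mx_diag mxE scaler_suml.
under [RHS]eq_bigr => i _ do rewrite exchange_big.
rewrite [RHS]exchange_big; apply: eq_bigr => k _; rewrite /mixed.
rewrite adjmx_sum mulmx_sumr scaler_sumr; apply: eq_bigr => i _.
rewrite mulmx_suml scaler_sumr; apply: eq_bigr => j _.
rewrite adjmxZ -!scalemxAl -scalemxAr !scalerA !mxE; congr (_ *: _).
by rewrite mulrAC [D 0 k * _]mulrC.
Qed.

End Mixing.

(** Unitary freedom of Kraus representations: the case of [mixed_sandwich] where all diagonal
    weights are 1. *)
Lemma mixed_unitary r V P : P^t* *m P = 1%:M :> 'M[C]_r ->
  kraus_map (mixed V P) = kraus_map V.
Proof.
move=> PP; apply/lfunP => X; rewrite !kraus_mapE.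
have := mixed_sandwich V P (const_mx 1) X.
rewrite diag_const_mx mulmx1 PP.
under eq_bigr => i _ do rewrite mxE scale1r.
move=> ->; apply: eq_bigr => i _; rewrite (bigD1 i) //= big1 => [|j ji].
  by rewrite mxE eqxx scale1r addr0.
by rewrite mxE eq_sym (negPf ji) scale0r.
Qed.

(** * Linear relations among products of Kraus operators *)

Section Relations.
Variables (r : nat) (V : 'I_r -> 'M[C]_(d1, d2)).

(** These are the changes of the map and of its dual at the identity when the coefficient matrix [1]
    is perturbed by [H]; the kernel consists of the perturbations that keep both constraints. *)
Definition sandwich_pair (H : 'M[C]_r) : 'M[C]_d2 * 'M[C]_d1 :=
  (\sum_i \sum_j H i j *: ((V i)^t* *m V j),
   \sum_i \sum_j H i j *: (V j *m (V i)^t*)).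

Fact sandwich_pair_is_linear : linear sandwich_pair.
Proof.
have lin m n (E : 'I_r -> 'I_r -> 'M[C]_(m, n)) a (H K : 'M[C]_r) :
    \sum_i \sum_j (a *: H + K) i j *: E i j =
    a *: (\sum_i \sum_j H i j *: E i j) + \sum_i \sum_j K i j *: E i j.
  rewrite scaler_sumr -big_split; apply: eq_bigr => i _.
  rewrite scaler_sumr -big_split; apply: eq_bigr => j _.
  by rewrite !mxE scalerDl scalerA.
by move=> a H K; rewrite /sandwich_pair !lin.
Qed.
HB.instance Definition _ :=
  GRing.isLinear.Build C 'M[C]_r ('M[C]_d2 * 'M[C]_d1)%type *:%R
    sandwich_pair sandwich_pair_is_linear.

Lemma sandwich_pair_adj H :
  sandwich_pair (H^t*) = (((sandwich_pair H).1)^t*, ((sandwich_pair H).2)^t*).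
Proof.
rewrite /sandwich_pair /=; congr pair; rewrite exchange_big adjmx_sum;
  apply: eq_bigr => i _; rewrite adjmx_sum; apply: eq_bigr => j _;
  by rewrite adjmxZ adjmxM trmxCK !mxE.
Qed.

(** Rank-nullity over the complex numbers: the source has dimension [r ^ 2], the target
    [d2 ^ 2 + d1 ^ 2]. *)
Lemma sandwich_pair_kernel : (d1 ^ 2 + d2 ^ 2 < r ^ 2)%N ->
  exists2 H, H != 0 & sandwich_pair H = 0.
Proof.
move=> big; pose f := linfun sandwich_pair.
have f0 : lker f != 0%VS.
  rewrite -dimv_eq0; apply/eqP => k0.
  have := limg_ker_dim f fullv; rewrite capfv k0 add0n => dim_im.
  have := dimvS (subvf (f @: fullv)); rewrite dim_im !dimvf /dim /=.
  by rewrite !mulnn addnC leqNgt big.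
exists (vpick (lker f)); first by rewrite vpick0.
by have := memv_pick (lker f); rewrite memv_ker lfunE => /eqP.
Qed.

(** The kernel is stable under adjoints, so it contains [H + H^t*]. If that vanishes, [H] is
    skew-Hermitian and ['i *: H] serves instead. *)
Lemma hermitian_relation : (d1 ^ 2 + d2 ^ 2 < r ^ 2)%N ->
  exists H, [/\ H != 0, H^t* = H & sandwich_pair H = 0].
Proof.
move=> /sandwich_pair_kernel [H H0 fH].
have fHa : sandwich_pair (H^t*) = 0.
  by rewrite sandwich_pair_adj fH /= !trmx0 !map_mx0.
have [HN|HN] := eqVneq (H + H^t*) 0.
  exists ('i *: H); split; last by rewrite linearZ /= fH scaler0.
    by rewrite scaler_eq0 negb_or neq0Ci.
  rewrite adjmxZ conjCi scaleNr -scalerN; congr (_ *: _).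
  by apply/eqP; rewrite eqr_oppLR -addr_eq0 addrC HN.
exists (H + H^t*); split => //; last by rewrite linearD /= fH fHa addr0.
by rewrite linearD /= map_mxD trmxCK addrC.
Qed.

End Relations.

Lemma diagonal_relation Phi r : kraus_length Phi r ->
  (d1 ^ 2 + d2 ^ 2 < r ^ 2)%N ->
  exists (W : 'I_r -> 'M[C]_(d1, d2)) (D : 'I_r -> R) (i0 : 'I_r),
  [/\ Phi = kraus_map W, forall i, -1 <= D i <= 1, D i0 = 1,
      \sum_i (D i)%:C%C *: ((W i)^t* *m W i) = 0 &
      \sum_i (D i)%:C%C *: (W i *m (W i)^t*) = 0].
Proof.
move=> /kraus_length_kraus_map [V ->] /hermitian_relation-/(_ V).
move=> [H [H0 Hherm fH]].
have Hh : H \is hermsymmx.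
  by apply/is_hermitianmxP; rewrite expr0 scale1r Hherm.
have := hermitian_normalmx Hh => /orthomx_spectralP.
set P := spectralmx H; set D := spectral_diag H.
have Pu : P \is unitarymx := spectral_unitarymx H.
rewrite invmx_unitary // => HE.
have PP : P^t* *m P = 1%:M.
  by rewrite -invmx_unitary // mulVmx // unitarymx_unit.
have Dreal i : D 0 i \is Num.real.
  by have /mxOverP := hermitian_spectral_diag_real Hh; apply.
have [i1 Di1] : exists i, D 0 i != 0.
  apply/existsP; apply: contra_neqT H0 => /existsPn D0.
  have -> : H = P^t* *m diag_mx D *m P by [].
  have -> : D = 0.
    by apply/rowP => i; rewrite [RHS]mxE; apply/eqP; rewrite -[_ == _]negbK D0.
  by rewrite linear0 mulmx0 mul0mx.
pose W := mixed V P.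
have rel1 : \sum_i D 0 i *: ((W i)^t* *m W i) = 0.
  transitivity (\sum_i D 0 i *: ((W i)^t* *m 1%:M *m W i)).
    by apply: eq_bigr => i _; rewrite mulmx1.
  rewrite mixed_sandwich -HE -[RHS](congr1 fst fH).
  by do 2![apply: eq_bigr => ? _]; rewrite mulmx1.
have rel2 : \sum_i D 0 i *: (W i *m (W i)^t*) = 0.
  by rewrite mixed_dual_sandwich -HE; case: fH.
pose d i : R := complex.Re (D 0 i).
have dE i : D 0 i = (d i)%:C%C by rewrite RRe_real.
(* Dividing by the eigenvalue of largest modulus, sign included, puts all of them in [[-1, 1]] and
   makes this one exactly 1. *)
have [i0 _ i0max] := arg_maxP (fun i => `|d i|) (isT : xpredT i1).
have di0 : d i0 != 0.
  rewrite -normr_gt0; apply: lt_le_trans (i0max i1 isT).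
  by rewrite normr_gt0; apply: contraNneq Di1 => d0; rewrite dE d0.
exists W, (fun i => d i / d i0), i0; split.
- by rewrite mixed_unitary.
- move=> i; rewrite -ler_norml normf_div ler_pdivrMr ?normr_gt0 // mul1r.
  exact: i0max.
- by rewrite divff.
- transitivity ((d i0)^-1%:C%C *: \sum_i D 0 i *: ((W i)^t* *m W i)).
    rewrite scaler_sumr; apply: eq_bigr => i _.
    by rewrite scalerA dE -rmorphM mulrC.
  by rewrite rel1 scaler0.
- transitivity ((d i0)^-1%:C%C *: \sum_i D 0 i *: (W i *m (W i)^t*)).
    rewrite scaler_sumr; apply: eq_bigr => i _.
    by rewrite scalerA dE -rmorphM mulrC.
  by rewrite rel2 scaler0.
Qed.

Lemma extreme_choi_rank A1 A2 Phi : extreme_points (CP_set A1 A2) Phi ->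
  (choi_rank Phi ^ 2 <= d1 ^ 2 + d2 ^ 2)%N.
Proof.
move=> [[cpPhi Phi1 dPhi1] ext]; rewrite leqNgt; apply/negP => big.
have [W [D [i0 [PhiW D1 Di0 rel1 rel2]]]] :=
  diagonal_relation (kraus_length_choi_rank cpPhi) big.
set r := choi_rank Phi in W D i0 PhiW D1 Di0 rel1 rel2 big.
(* The perturbed family has weights [1 + s D i], nonnegative for [|s| <= 1]; only [s = 1] and
   [s = -1] will matter. *)
pose w (s : R) (i : 'I_r) : C := (1 + s * D i)%:C%C.
pose Psi s := kraus_map (weighted (w s) W).
have w_ge0 s i : `|s| <= 1 -> 0 <= w s i.
  move=> s1; rewrite /w lecR -lerBlDl sub0r.
  have : `|s * D i| <= 1.
    by rewrite normrM mulr_ile1 // ler_norml.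
  by rewrite ler_norml => /andP[].
have wE s m n (E : 'I_r -> 'M[C]_(m, n)) :
    \sum_i w s i *: E i = \sum_i E i + s%:C%C *: \sum_i (D i)%:C%C *: E i.
  rewrite scaler_sumr -big_split; apply: eq_bigr => i _.
  by rewrite /w rmorphD rmorph1 rmorphM scalerDl scale1r scalerA.
have PsiE s X : `|s| <= 1 -> Psi s X =
    Phi X + s%:C%C *: \sum_i (D i)%:C%C *: ((W i)^t* *m X *m W i).
  move=> s1; rewrite {1}PhiW !kraus_mapE -wE; apply: eq_bigr => i _.
  by rewrite weighted_sandwich // w_ge0.
have PsiCP s : `|s| <= 1 -> CP_set A1 A2 (Psi s).
  move=> s1; split; first by exists r; exact: kraus_length_map.
    rewrite PsiE // Phi1.
    under eq_bigr => i _ do rewrite mulmx1.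
    by rewrite rel1 scaler0 addr0.
  rewrite dual_kraus_map1 -dPhi1 PhiW dual_kraus_map1.
  under eq_bigr => i _ do rewrite weighted_dual_sandwich ?w_ge0 //.
  by rewrite wE rel2 scaler0 addr0.
have half_gt0 : 0 < 2^-1 :> R by rewrite invr_gt0.
have half_lt1 : 2^-1 < 1 :> R by rewrite invf_lt1 // ltr1n.
have n1 : `|1 : R| <= 1 by rewrite normr1.
have nN1 : `|-1 : R| <= 1 by rewrite normrN normr1.
(* The terms linear in [s] cancel, so the map is the midpoint of the two perturbations. *)
have mid : Phi = (2^-1)%:C%C *: Psi 1 + (1 - 2^-1)%:C%C *: Psi (-1).
  apply/lfunP => X; rewrite add_lfunE !scale_lfunE !PsiE //.
  have -> : 1 - 2^-1 = 2^-1 :> R.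
    by apply/eqP; rewrite subr_eq -div1r -splitr.
  rewrite -scalerDr addrACA rmorph1 rmorphN1 scaleN1r scale1r subrr addr0.
  rewrite -mulr2n -scaler_nat scalerA fmorphV rmorph_nat mulVf ?scale1r //.
have [_ PsiN] := ext _ _ _ (PsiCP 1 n1) (PsiCP (-1) nN1) half_gt0 half_lt1 mid.
(* At [s = -1] the weight of [i0] is [1 - D i0 = 0], so one operator drops out and minimality of [r]
   is contradicted. *)
have WN0 : weighted (w (-1)) W i0 = 0.
  by rewrite /weighted /w Di0 mulr1 subrr sqrtC0 scale0r.
(* Positivity matters: for [r = 0] the truncated predecessor would give no contradiction. *)
have r_gt0 : (0 < r)%N := leq_ltn_trans (leq0n _) (ltn_ord i0).
have : (r <= r.-1)%N; last by rewrite leqNgt prednK // leqnn.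
apply: choi_rank_le; rewrite -PsiN.
exact: kraus_length_drop0 WN0.
Qed.

End Kraus.

(** * Lower bounds on the Choi rank, and extremality of column maps *)

Section Lower.
Variables (R : realType) (d1 d2 : nat).
Local Notation C := (complex R).
Implicit Types Phi Psi : linmap R d1 d2.

Lemma kraus_rank1 r (U : 'I_r -> 'M[C]_(d1, d2)) (x : 'cV[C]_d1) :
  kraus_map U (x *m x^t*) = \sum_k (x^t* *m U k)^t* *m (x^t* *m U k).
Proof.
by rewrite kraus_mapE; apply: eq_bigr => k _; rewrite adjmxM trmxCK !mulmxA.
Qed.

Lemma kraus_rank1_diag r (U : 'I_r -> 'M[C]_(d1, d2)) (x : 'cV[C]_d1) j :
  kraus_map U (x *m x^t*) j j = \sum_k `|(x^t* *m U k) 0 j| ^+ 2.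
Proof.
rewrite kraus_rank1 summxE; apply: eq_bigr => k _.
by rewrite mxE big_ord1 !mxE normCKC.
Qed.

(** On [x *m x^t*] each Kraus operator contributes a column times a row, hence rank at most one. *)
Lemma choi_rank_ge Phi (x : 'cV[C]_d1) : completely_positive Phi ->
  (\rank (Phi (x *m x^t*)) <= choi_rank Phi)%N.
Proof.
move=> /kraus_length_choi_rank /kraus_length_kraus_map [U {1}->].
rewrite kraus_rank1; set r := choi_rank Phi in U *.
rewrite -[X in (_ <= X)%N](card_ord r) -sum1_card.
apply: (big_ind2 (fun (A : 'M[C]_d2) n => (\rank A <= n)%N)).
- by rewrite mxrank0.
- move=> A m B n Am Bn; apply: leq_trans (mxrank_add _ _) _; exact: leq_add.
- by move=> k _; apply: leq_trans (mxrankM_maxl _ _) (rank_leq_col _).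
Qed.

(** Such a map is the entrywise product of the Gram matrix of the coefficients [c] with a matrix
    depending only on [w] and [X]; the Gram matrix is thus all that can vary. *)
Lemma kraus_col_entry r (U : 'I_r -> 'M[C]_(d1, d2)) (w : 'I_d2 -> 'cV[C]_d1)
    (c : 'I_r -> 'I_d2 -> C) X i j :
  (forall k j, col j (U k) = c k j *: w j) ->
  kraus_map U X i j =
    (\sum_k (c k i)^* * c k j) * ((w i)^t* *m X *m w j) 0 0.
Proof.
move=> colU; rewrite kraus_mapE summxE mulr_suml; apply: eq_bigr => k _.
transitivity (((col i (U k))^t* *m X *m col j (U k)) 0 0).
  rewrite !mxE; apply: eq_bigr => l _; rewrite !mxE; congr (_ * _).
  by apply: eq_bigr => m _; rewrite !mxE.
by rewrite !colU adjmxZ -!scalemxAl -scalemxAr scalerA mxE.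
Qed.

Section Columns.
Variable w : 'I_d2 -> 'cV[C]_d1.
Hypothesis w_nonorthogonal : forall i j, ((w i)^t* *m w j) 0 0 != 0.

Definition column_kraus j : 'M[C]_(d1, d2) := w j *m delta_mx 0 j.

Lemma col_column_kraus k j : col j (column_kraus k) = (k == j)%:R *: w j.
Proof.
apply/colP => i; rewrite !mxE big_ord1 !mxE eqxx /= eq_sym.
by case: eqP => [->|_]; rewrite ?mulr1 ?mul1r ?mulr0 ?mul0r.
Qed.

Lemma column_map_entry X i j :
  kraus_map column_kraus X i j = (i == j)%:R * ((w i)^t* *m X *m w j) 0 0.
Proof.
rewrite (kraus_col_entry X i j col_column_kraus); congr (_ * _).
rewrite (bigD1 i) //= big1 => [|k ki].
  by rewrite eqxx rmorph1 mul1r addr0.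
by rewrite (negPf ki) rmorph0 mul0r.
Qed.

Lemma column_map_dual : dual_map (kraus_map column_kraus) 1%:M =
  \sum_j w j *m (w j)^t*.
Proof.
rewrite dual_kraus_map1; apply: eq_bigr => j _.
rewrite /column_kraus adjmxM adjmx_delta -mulmxA [delta_mx _ _ *m _]mulmxA.
rewrite mul_delta_mx; congr (_ *m _); rewrite -[RHS]mul1mx; congr (_ *m _).
by apply/matrixP => i k; rewrite !ord1 !mxE.
Qed.

(* A map below [kraus_map column_kraus] vanishes wherever the latter does on
   diagonal entries, so column [j] of each of its Kraus operators is orthogonal
   to the orthogonal complement of [w j]. *)
Lemma dominated_column r (U : 'I_r -> 'M[C]_(d1, d2)) Psi (t : R) k j :
  0 < t -> t < 1 -> completely_positive Psi ->
  kraus_map column_kraus =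
    t%:C%C *: kraus_map U + (1 - t)%:C%C *: Psi ->
  exists c, col j (U k) = c *: w j.
Proof.
move=> t0 t1 [s /kraus_length_kraus_map [V ->]] dec.
(* [c *: w j] is the orthogonal projection of [u] onto the line of [w j], and [x] is the residue, to
   be shown zero. *)
pose u := col j (U k); pose c := ((w j)^t* *m u) 0 0 / ((w j)^t* *m w j) 0 0.
pose x := u - c *: w j.
have wx : (w j)^t* *m x = 0.
  apply/matrixP => a b; rewrite !ord1 /x mulmxBr -scalemxAr.
  by rewrite mxE [X in _ + X]mxE [X in _ - X]mxE /c divfK // subrr mxE.
have xw : x^t* *m w j = 0.
  by rewrite -[w j]trmxCK -adjmxM wx trmx0 map_mx0.
(* At [x *m x^t*] the [(j, j)] entry of the left side is 0, and both terms on the right are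
   nonnegative, so each vanishes. *)
have /eqP := congr1 (fun F : linmap R d1 d2 => F (x *m x^t*) j j) dec.
rewrite add_lfunE !scale_lfunE !mxE column_map_entry eqxx mul1r mulmxA wx.
rewrite !mul0mx mxE eq_sym !kraus_rank1_diag.
have sum_ge0 n (A : 'I_n -> 'M[C]_(d1, d2)) :
    0 <= \sum_i `|(x^t* *m A i) 0 j| ^+ 2.
  by apply: sumr_ge0 => i _; rewrite exprn_ge0.
have t0C : 0 < t%:C%C :> C by rewrite ltcR.
have t1C : 0 <= (1 - t)%:C%C :> C by rewrite lecR subr_ge0 ltW.
rewrite paddr_eq0 ?mulr_ge0 ?(ltW t0C) // mulf_eq0 (gt_eqF t0C) /=.
rewrite psumr_eq0 => [/andP[/allP xU _]|i _]; last by rewrite exprn_ge0.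
have /eqP xUk : (x^t* *m U k) 0 j == 0.
  by have := xU k (mem_index_enum _); rewrite /= sqrf_eq0 normr_eq0.
have xu : x^t* *m u = 0.
  apply/matrixP => a b; rewrite !ord1 mxE [RHS]mxE -[RHS]xUk mxE.
  by apply: eq_bigr => i _; rewrite [u _ _]mxE.
(* Being orthogonal to [u] and to [w j], the residue is orthogonal to itself. *)
have xx : x^t* *m x = 0.
  by rewrite {2}/x mulmxBr xu -scalemxAr xw scaler0 subr0.
exists c; apply/eqP; rewrite -subr_eq0 -/u -/x; apply/eqP/colP => i.
have /eqP := congr1 (fun M : 'M[C]_1 => M 0 0) xx; rewrite !mxE psumr_eq0.
  move=> /allP/(_ i (mem_index_enum _)) /=.
  by rewrite !mxE -normCKC sqrf_eq0 normr_eq0 => /eqP.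
by move=> l _; rewrite !mxE -normCKC exprn_ge0.
Qed.

(** By [dominated_column] only the Gram matrix of the column coefficients of [Psi1] is free. The
    value at the identity determines it, since every inner product of [w i] and [w j] can be
    cancelled. *)
Lemma dominated_eq Psi1 Psi2 (t : R) :
  0 < t -> t < 1 -> completely_positive Psi1 -> completely_positive Psi2 ->
  Psi1 1%:M = kraus_map column_kraus 1%:M ->
  kraus_map column_kraus = t%:C%C *: Psi1 + (1 - t)%:C%C *: Psi2 ->
  Psi1 = kraus_map column_kraus.
Proof.
move=> t0 t1 [r /kraus_length_kraus_map [U ->]] cp2 U1 dec.
have col_U k : exists ck, forall j, col j (U k) = ck j *: w j.
  have [ck ckP] := choice (fun j => dominated_column k j t0 t1 cp2 dec).
  by exists ck.
have [c cP] := choice col_U.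
apply/lfunP => X; apply/matrixP => i j.
rewrite column_map_entry (kraus_col_entry X i j cP); congr (_ * _).
apply: (mulIf (w_nonorthogonal i j)).
have := congr1 (fun M : 'M[C]_d2 => M i j) U1.
by rewrite column_map_entry (kraus_col_entry _ i j cP) mulmx1.
Qed.

Lemma column_map_extreme A1 A2 : CP_set A1 A2 (kraus_map column_kraus) ->
  extreme_points (CP_set A1 A2) (kraus_map column_kraus).
Proof.
move=> cpset; split=> // Psi1 Psi2 t [cp1 Psi11 _] [cp2 Psi21 _] t0 t1 dec.
have [_ Phi1 _] := cpset.
have t10 : 0 < 1 - t by rewrite subr_gt0.
have t11 : 1 - t < 1 by rewrite ltrBlDr ltrDl.
(* Exchanging [t] and [1 - t] lets the same argument treat [Psi2]. *)
have dec' : kraus_map column_kraus =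
    (1 - t)%:C%C *: Psi2 + (1 - (1 - t))%:C%C *: Psi1.
  by rewrite subKr addrC.
split; first by apply: (dominated_eq t0 t1 cp1 cp2 _ dec); rewrite Psi11 Phi1.
by apply: (dominated_eq t10 t11 cp2 cp1 _ dec'); rewrite Psi21 Phi1.
Qed.

End Columns.
End Lower.

(** * Unit phases built from cube roots of unity *)

Lemma cube_root_unity (C : numClosedFieldType) :
  exists2 om : C, om^* = om ^+ 2 & 1 + om + om ^+ 2 = 0.
Proof.
(* The root will be [(y - 1) / 2], that is [(-1 + i sqrt 3) / 2]. *)
pose y : C := 'i * sqrtC 3.
have y2 : y ^+ 2 = - 3 by rewrite exprMn sqrCi sqrtCK mulN1r.
have yc : y^* = - y.
  by rewrite rmorphM /= conjCi mulNr; congr (- (_ * _)); apply: geC0_conj;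
     rewrite sqrtC_ge0 ler0n.
have two : (2 : C) != 0 by rewrite pnatr_eq0.
have om2 : ((y - 1) / 2) ^+ 2 = (- 1 - y) / 2.
  have -> : ((y - 1) / 2) ^+ 2 = (y ^+ 2 - 2 * y + 1) / 4 by field.
  by rewrite y2; field.
exists ((y - 1) / 2); rewrite om2; last by field.
rewrite rmorphM /= fmorphV rmorph_nat rmorphB rmorph1 /= yc; congr (_ / _).
exact: addrC.
Qed.

Lemma unit_phases (C : numClosedFieldType) (n : nat) :
  exists z : 'I_n.+2 -> C, [/\ \sum_i z i = n%:R - 1,
    forall i, (z i)^* * z i = 1 & forall i j, 1 + (z i)^* * z j != 0].
Proof.
have [om omc om1] := cube_root_unity C.
have om3 : om ^+ 3 = 1.
  apply/eqP; rewrite -subr_eq0; apply/eqP.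
  transitivity ((om - 1) * (1 + om + om ^+ 2)); first by ring.
  by rewrite om1 mulr0.
(* Exponents of [om]: 1, then 2, then the default 0 of [nth] for the [n] phases equal to 1. *)
pose f (i : 'I_n.+2) := nth 0%N [:: 1%N; 2%N] i.
have fc i : (om ^+ f i)^* = om ^+ (2 * f i) by rewrite rmorphXn /= omc exprM.
exists (fun i => om ^+ f i); split.
- rewrite !big_ord_recl /f /=.
  under eq_bigr => i _ do rewrite nth_nil expr0.
  rewrite sumr_const card_ord.
  transitivity (n%:R - 1 + (1 + om + om ^+ 2)); first by ring.
  by rewrite om1 addr0.
- by move=> i; rewrite fc -exprD -mulSnr exprM om3 expr1n.
- move=> i j; rewrite fc -exprD; apply/eqP => /eqP.
  (* Otherwise a power of [om] equals -1, and cubing gives [1 = -1]. *)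
  rewrite addrC addr_eq0 => /eqP /(congr1 (fun x => x ^+ 3)).
  rewrite exprAC om3 expr1n -signr_odd expr1 => /eqP.
  by rewrite -subr_eq0 opprK -mulr2n pnatr_eq0.
Qed.

(** * An extreme map of Choi rank d *)

Section Example.
Variables (R : realType) (d : nat).
Local Notation C := (complex R).

Lemma phase_column_map (z : 'I_d -> C) : (0 < d)%N ->
  \sum_i z i = d%:R - 3 -> (forall i, (z i)^* * z i = 1) ->
  (forall i j, 1 + (z i)^* * z j != 0) ->
  exists2 Phi : linmap R 2 d,
    extreme_points (CP_set (Zmat R d) (d%:R^-1 *: 1%:M)) Phi &
    choi_rank Phi = d.
Proof.
move=> d0 zsum zz z1; pose s : C := sqrtC ((2 * d%:R)^-1).
have dn0 : d%:R != 0 :> C by rewrite pnatr_eq0 -lt0n.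
have two : (2 : C) != 0 by rewrite pnatr_eq0.
have s2ge0 : 0 <= (2 * d%:R)^-1 :> C by rewrite invr_ge0 mulr_ge0 ?ler0n.
have sc : s^* = s by apply: geC0_conj; rewrite sqrtC_ge0.
have ss : s * s = (2 * d%:R)^-1 by rewrite -expr2 sqrtCK.
have s0 : (2 * d%:R)^-1 != 0 :> C by rewrite invr_eq0 mulf_neq0.
(* With [s ^ 2 = 1 / (2 d)] and unit phases, each [w j] has squared norm [1 / d]. The sum of the
   [w j *m (w j)^t*] has diagonal [1 / 2], and its off-diagonal entries are the phase sum and its
   conjugate over [2 d]. *)
pose w j : 'cV[C]_2 := \col_k (s * (if k == 0 then 1 else z j)).
have wE i j : ((w i)^t* *m w j) 0 0 = (2 * d%:R)^-1 * (1 + (z i)^* * z j).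
  rewrite mxE big_ord_recl big_ord1 !mxE /= !rmorphM /= sc rmorph1 -ss.
  by ring.
have wn0 i j : ((w i)^t* *m w j) 0 0 != 0 by rewrite wE mulf_neq0.
pose Phi := kraus_map (column_kraus w).
have Phi_ext : extreme_points (CP_set (Zmat R d) (d%:R^-1 *: 1%:M)) Phi.
  apply: column_map_extreme => //; split.
  - by exists d; exact: kraus_length_map.
  - apply/matrixP => i j; rewrite column_map_entry mulmx1 wE !mxE.
    case: eqP => [->|_]; rewrite ?mul0r ?mulr0 // zz.
    by field.
  rewrite column_map_dual; apply/matrixP => a b; rewrite summxE.
  under eq_bigr => i _ do rewrite mxE big_ord1 !mxE rmorphM /= sc mulrACA ss.
  rewrite -mulr_sumr !mxE.
  have zcsum : \sum_i (z i)^* = d%:R - 3.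
    by rewrite -rmorph_sum zsum rmorphB !rmorph_nat.
  have ord2 (e : 'I_2) : e = 0 \/ e = 1.
    by case: e => [[|[|]]] // p; [left|right]; exact: val_inj.
  have [->|->] := ord2 a; have [->|->] := ord2 b; rewrite /=.
  - rewrite rmorph1 mulr1 sumr_const card_ord; by field.
  - under eq_bigr => i _ do rewrite mul1r.
    rewrite zcsum; by field.
  - under eq_bigr => i _ do rewrite rmorph1 mulr1.
    rewrite zsum; by field.
  - under eq_bigr => i _ do rewrite mulrC zz.
    rewrite sumr_const card_ord; by field.
exists Phi => //; have [[cp _ _] _] := Phi_ext.
apply/eqP; rewrite eqn_leq (choi_rank_le (kraus_length_map _)) /=.
(* All [w j] share the first coordinate [s], so the image of [x *m x^t*] is a nonzero scalar matrix,
   of full rank [d]. *)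
pose x : 'cV[C]_2 := delta_mx 0 0.
apply: leq_trans (choi_rank_ge x cp).
have xw j : (x^t* *m w j) 0 0 = s by rewrite adjmx_delta -rowE !mxE mulr1.
have wx i : ((w i)^t* *m x) 0 0 = s by rewrite -colE !mxE mulr1.
have -> : Phi (x *m x^t*) = ((2 * d%:R)^-1)%:M.
  apply/matrixP => i j; rewrite column_map_entry mulmxA -mulmxA.
  rewrite mxE big_ord1 wx xw ss mxE.
  by case: eqP => _; rewrite ?mul1r ?mul0r.
by rewrite mxrank_unit // unitmxE det_scalar unitrX // unitfE.
Qed.

End Example.

(** The radicand is [d ^ 2 + 3], and [d ^ 2 + 3 < (d + 1) ^ 2] amounts to [1 < d]. *)
Lemma floor_sqrt_dim (R : realType) (d : nat) : (1 < d)%N ->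
  Num.floor (Num.sqrt (2 ^+ 2 + d%:R ^+ 2 - 1 : R)) = d%:Z.
Proof.
move=> d1; apply: floor_def; have d0 : 0 <= d%:R :> R by rewrite ler0n.
have d1R : 1 < d%:R :> R by rewrite ltr1n.
rewrite rmorphD /= -pmulrn; apply/andP; split.
  rewrite -[leLHS]ger0_norm // -sqrtr_sqr ler_wsqrtr //.
  by rewrite -subr_ge0; nra.
rewrite -[ltRHS]ger0_norm ?addr_ge0 // -sqrtr_sqr ltr_sqrt.
  by nra.
by nra.
Qed.

Theorem corollary5p3 (R : realType) (d : nat) (hd : (4 <= d)%N) :
  MR (Zmat R d) ((d%:R)^-1 *: 1%:M : 'M[complex R]_d) = (d%:R)%:E
  /\ d%:Z = Num.floor (Num.sqrt (2 ^+ 2 + d%:R ^+ 2 - 1 : R)).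
Proof.
split; last by rewrite floor_sqrt_dim // (leq_trans _ hd).
apply/eqP; rewrite eq_le; apply/andP; split.
  apply: ge_ereal_sup => _ [Phi /extreme_choi_rank rk <-].
  (* A rank of at least [d + 1] would force [(d + 1) ^ 2 <= d ^ 2 + 4], that is [2 d <= 3]. *)
  rewrite lee_fin ler_nat leqNgt; apply/negP => ltd.
  by move: rk; rewrite leqNgt => /negP; apply; nia.
(* [n = d - 2] counts the phases equal to 1, so the phase sum [n - 1] is [d - 3]. *)
have [n dn] : exists n, d = n.+2 by exists d.-2; lia.
have [z [zsum zz z1]] := unit_phases (complex R) n.
have zsum' : \sum_i z i = n.+2%:R - 3 by rewrite zsum -[n.+2]addn2 natrD; ring.
subst d; have [Phi Phi_ext rk] := phase_column_map (ltn0Sn _) zsum' zz z1.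
by apply: ereal_sup_ubound; exists Phi => //; rewrite rk.
Qed.
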